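(* There is an absolute constant $C$ such that for every odd prime $p$ and every integer $n\ge2$ the following holds. Let $$|\psi\rangle=\Big(I^{\otimes(n-1)}\otimes\big(A_{\pi/p}^\dagger H\big)^{\otimes(n-1)}\otimes\big(e^{-i\pi X/4}H\big)\Big)|\mathrm{PM}_n\rangle,$$ where the identities act on the edge qubits, the $A_{\pi/p}^\dagger H$ factors on the vertex qubits $v_1,\dots,v_{n-1}$, and the last factor on the root vertex qubit $v_0$. Then the distribution $P_\psi$ on $\{0,1\}^{2n-2}\times\{0,1\}$ obtained by measuring $|\psi\rangle$ in the computational basis satisfies $$\Delta\big(P_\psi,(Z,\mathrm{pmmajmod}_p(Z))\big)\le\tfrac12-\tfrac1\pi+\tfrac1{2p}+Cp^{3/2}e^{-n/(4p^2)},$$ where $Z$ is uniform on $\{0,1\}^{2n-2}$.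
   Context: $H$ Hadamard, $X$ Pauli-$X$, $A_\theta=|0\rangle\langle0|+e^{-i\theta X}|1\rangle\langle1|$ (non-unitary). Measurement of a nonzero vector gives outcome $z$ with probability $|\langle z|\psi\rangle|^2/\|\psi\|^2$. Binary tree $B_n$: vertices $v_0,\dots,v_{n-1}$, root $v_0$; parent of $v_i$ ($i\ge1$) is $v_{\lfloor(i-1)/2\rfloor}$, $e_i$ joins $v_i$ to its parent; $h(d)_i=\bigoplus_{j:\,e_j\text{ on path }v_0\to v_i}d_j$ for $d\in\{0,1\}^{n-1}$. $|\mathrm{PM}_n\rangle=\sum_{d}2^{-(n-1)/2}|d\rangle\otimes\frac1{\sqrt2}(|h(d)\,0\rangle+|\overline{h(d)}\,1\rangle)$, qubits ordered $e_1,\dots,e_{n-1},v_1,\dots,v_{n-1},v_0$. For odd prime $p$ and integer $a$, $\mathrm{MM}_p(a)=0$ if $(a\bmod p)\in\{0,\dots,(p-1)/2\}$ and $1$ otherwise. For $z=(d,x)\in\{0,1\}^{n-1}\times\{0,1\}^{n-1}$, $\mathrm{pmmajmod}_p(z)=\mathrm{MM}_p(\sum_{i}x_i(-1)^{h(d)_i})\oplus\mathrm{parity}(x)$. $\Delta$ is total variation distance. *)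

(* Defs.v *)
From HB Require Import structures.
From mathcomp Require Import all_boot all_order all_algebra.
From mathcomp Require Import all_classical all_reals all_analysis.
From mathcomp Require Import complex Rstruct Rstruct_topology.
Set Implicit Arguments. Unset Strict Implicit. Unset Printing Implicit Defensive.
Import Order.TTheory GRing.Theory Num.Theory.
Local Open Scope ring_scope.

Definition RR : realType := Rdefinitions.R.
Notation CC := (RR[i]).

Definition rc (x : RR) : CC := Complex x 0.
Definition sqnorm (c : CC) : RR := let: Complex a b := c in a ^+ 2 + b ^+ 2.

Definition bo (b : bool) : 'I_2 := @inord 1 (nat_of_bool b).

Definition Had : 'M[CC]_2 :=
  \matrix_(i < 2, j < 2)
     (if (i == 1 :> nat) && (j == 1 :> nat) then - rc (Num.sqrt 2)^-1
      else rc (Num.sqrt 2)^-1).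
Definition PauliX : 'M[CC]_2 := \matrix_(i < 2, j < 2) (if i == j then 0 else 1).
(* e^{-i theta X} = cos(theta) I - i sin(theta) X   (since X^2 = I) *)
Definition expmiX (theta : RR) : 'M[CC]_2 :=
  rc (cos theta) *: 1%:M - (Complex 0 (sin theta)) *: PauliX.
(* A_theta = |0><0| + e^{-i theta X} |1><1|  (non-unitary) *)
Definition Aop (theta : RR) : 'M[CC]_2 :=
  delta_mx 0 0 + expmiX theta *m delta_mx 1 1.
Definition adjM (M : 'M[CC]_2) : 'M[CC]_2 := map_mx (@Num.conj _) M^T.

(* ---------- n-qubit register: 2n-1 qubits ordered e_1..e_{n-1}, v_1..v_{n-1}, v_0 ---------- *)
Definition nq (n : nat) : nat := (n.-1 + n.-1).+1.
Definition bits (n : nat) := {ffun 'I_(nq n) -> bool}.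

(* edge qubit e_j (1 <= j <= n-1), vertex qubit v_i (1 <= i <= n-1), root qubit v_0 *)
Definition edge n (z : bits n) (j : nat) : bool := z (@inord (n.-1 + n.-1) (j.-1)).
Definition vtx n (z : bits n) (i : nat) : bool := z (@inord (n.-1 + n.-1) (n.-1 + i.-1)).
Definition root n (z : bits n) : bool := z (@inord (n.-1 + n.-1) (n.-1 + n.-1)).

Definition parent (i : nat) : nat := (i.-1)./2.
Definition anc (j i : nat) : bool := [exists k : 'I_i.+1, iter k parent i == j].
(* edge e_j (j>=1, joining v_j to its parent) lies on the path v_0 -> v_i *)
Definition on_path (j i : nat) : bool := (1 <= j)%N && anc j i.
Definition hfun (n : nat) (d : nat -> bool) (i : nat) : bool :=
  \big[xorb/false]_(1 <= j < n | on_path j i) d j.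
Definition hz n (z : bits n) (i : nat) : bool := hfun n (edge z) i.

Definition indC (b : bool) : CC := (nat_of_bool b)%:R.
Definition PM (n : nat) (z : bits n) : CC :=
  rc ((Num.sqrt 2) ^- n.-1) * rc (Num.sqrt 2)^-1 *
  ( indC ([forall i : 'I_n, (1 <= i)%N ==> (vtx z i == hz z i)] && (root z == false))
  + indC ([forall i : 'I_n, (1 <= i)%N ==> (vtx z i == ~~ hz z i)] && (root z == true))).

Definition apply_local n (U : 'I_(nq n) -> 'M[CC]_2) (psi : bits n -> CC) (z : bits n) : CC :=
  \sum_(w : bits n) (\prod_(j < nq n) U j (bo (z j)) (bo (w j))) * psi w.

Definition opsPM (p n : nat) (j : 'I_(nq n)) : 'M[CC]_2 :=
  if (j < n.-1)%N then 1%:M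
  else if (j < n.-1 + n.-1)%N then adjM (Aop (pi / p%:R)) *m Had
  else expmiX (pi / 4) *m Had.

Definition psi (p n : nat) : bits n -> CC := @apply_local n (@opsPM p n) (@PM n).

Definition meas_dist n (phi : bits n -> CC) (z : bits n) : RR :=
  sqnorm (phi z) / \sum_(w : bits n) sqnorm (phi w).

Definition MM (p : nat) (a : int) : bool :=
  ~~ ((a %% p%:Z)%Z <= ((p.-1)./2)%:Z).
Definition parity_x n (z : bits n) : bool := \big[xorb/false]_(1 <= i < n) vtx z i.
Definition pmmajmod (p n : nat) (z : bits n) : bool :=
  MM p (\sum_(1 <= i < n) (nat_of_bool (vtx z i))%:Z * (-1) ^+ (nat_of_bool (hz z i)))
  (+) parity_x z.

(* law of (Z, pmmajmod_p(Z)) with Z uniform on {0,1}^{2n-2}; last bit = v_0 slot *)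
Definition target_dist (p n : nat) (z : bits n) : RR :=
  (2 ^+ (n.-1 + n.-1))^-1 * (nat_of_bool (root z == pmmajmod p z))%:R.

Definition tvd n (P Q : bits n -> RR) : RR := 2^-1 * \sum_(z : bits n) `|P z - Q z|.

(* Main.v *)
Require Import Defs.
From HB Require Import structures.
From mathcomp Require Import all_boot all_order all_algebra.
From mathcomp Require Import all_classical all_reals all_analysis.
From mathcomp Require Import complex Rstruct Rstruct_topology.
From mathcomp Require Import trigo.
From mathcomp Require Import ring lra zify.
Import Order.TTheory GRing.Theory Num.Theory.
Import numFieldNormedType.Exports.
Local Open Scope ring_scope.

(* Write [m = n - 1] and [S = \sum_i x_i (-1)^(h(d)_i)]. Each outcome
    [(d, x, b)] receives amplitude from exactly two basis states of the poor
    man's cat state, and the two contributions are complex conjugate up to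
    signs; the squared amplitude is
    [2^(-2m) (1 + (-1)^(parity x + b) sin (2 pi S / p)) / 2]. The state thus has
    norm 1 and the distance to the target is [(1 - E g(S)) / 2] for the
    [p]-periodic function [g(s) = (-1)^(MM s) sin (2 pi s / p)].

    Flipping [d_i] and [x_i] shows that [S] behaves as a lazy random walk, with
    [E cos (t S - c) = ((1 + cos t) / 2)^m cos c]. Expanding [g] in characters
    of [Z/p], the trivial character contributes the mean of [g] over [Z/p],
    which is [cot (pi / (2 p)) / p >= 2 / pi - 1 / p], and every other character
    is damped by [cos^2 (pi k / p) <= exp (- 1 / p^2)] at each of the [m] steps. *)

(** * Trigonometric sums, bounds on the sine, and characters of [Z/p] *)

Section RealTrigonometry.
Variable R : realType.
Implicit Types (x y : R) (m s : int).

Lemma sinD2piz x m : sin (x + 2 * pi * m%:~R) = sin x.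
Proof.
have per n y : sin (y + 2 * pi * n%:R) = sin y.
  rewrite -[RHS](periodicn (@sinD2pi R) n); congr sin.
  by rewrite -[in RHS]mulr_natr -(mulr_natl pi 2).
case: m => n; first exact: per.
by rewrite -[LHS](per n.+1) NegzE mulrNz mulrN subrK.
Qed.

(** Telescoping: [2 sin (x/2) cos (k x)] is the difference of the sines at [k x + x/2] and
    [k x - x/2]. *)
Lemma sum_cos_arith x n :
  2 * sin (x / 2) * (\sum_(k < n) cos (k%:R * x)) =
  sin (n%:R * x - x / 2) + sin (x / 2).
Proof.
elim: n => [|n IHn].
  by rewrite big_ord0 mulr0 mul0r sub0r sinN addNr.
rewrite big_ord_recr /= mulrDr IHn.
have -> : n.+1%:R * x - x / 2 = n%:R * x + x / 2 by rewrite -natr1; field.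
by rewrite sinB sinD; ring.
Qed.

Lemma sum_sin_arith x n :
  2 * sin (x / 2) * (\sum_(k < n) sin (k%:R * x)) =
  cos (x / 2) - cos (n%:R * x - x / 2).
Proof.
elim: n => [|n IHn].
  by rewrite big_ord0 mulr0 mul0r sub0r cosN subrr.
rewrite big_ord_recr /= mulrDr IHn.
have -> : n.+1%:R * x - x / 2 = n%:R * x + x / 2 by rewrite -natr1; field.
by rewrite cosB cosD; ring.
Qed.

Lemma sin_chord y : 0 <= y -> exists2 c, 0 <= c <= y & sin y = y * cos c.
Proof.
move=> y0.
have [|c cy E] := @MVT_segment R sin cos 0 y y0 (fun x _ => is_derive_sin x).
  exact/continuous_subspaceT/continuous_sin.
exists c; first by move: cy; rewrite in_itv.
by move: E; rewrite sin0 !subr0 mulrC.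
Qed.

Lemma sin_le y : 0 <= y -> sin y <= y.
Proof.
by move=> y0; have [c _ ->] := sin_chord y y0; rewrite ler_piMr ?cos_le1.
Qed.

Lemma cos_piquarter_sqr : cos (pi / 4 : R) ^+ 2 = 2^-1.
Proof.
have := cos_mulr2n (pi / 4 : R).
have -> : (pi / 4 : R) *+ 2 = pi / 2 by rewrite -mulr_natr; field.
by rewrite cos_pihalf => /esym; rewrite -mulr_natr => h; lra.
Qed.

(** [sin y = 2 sin (y/2) cos (y/2) = y cos c cos (y/2)] with [c] in [[0, y/2]]; both cosines are at
    least [cos (pi/4)], whose square is [1/2]. *)
Lemma sin_ge_half y : 0 <= y <= pi / 2 -> y / 2 <= sin y.
Proof.
move=> /andP[y0 y1].
have yh0 : 0 <= y / 2 by lra.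
have [c /andP[c0 c1] E] := sin_chord (y / 2) yh0.
have -> : y = (y / 2) *+ 2 by rewrite -mulr_natr; field.
rewrite sin_mulr2n E -(mulr_natr (cos _ * _)) -(mulr_natr (y / 2)).
have p0 := pi_gt0 R.
have c4 : 0 <= cos (pi / 4 : R) by apply: cos_ge0_pihalf; lra.
have cosW z : 0 <= z <= pi / 4 -> cos (pi / 4 : R) <= cos z.
  move=> /andP[z0 z1]; rewrite leNgt ltr_cos ?in_itv /=; last 2 first.
  - by apply/andP; split; lra.
  - by apply/andP; split; lra.
  by rewrite -leNgt.
have h1 : cos (pi / 4 : R) <= cos (y / 2) by apply: cosW; lra.
have h2 : cos (pi / 4 : R) <= cos c by apply: cosW; lra.
have := ler_pM c4 c4 h1 h2; rewrite -expr2 cos_piquarter_sqr => h.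
have -> : y / 2 * 2 / 2 = y * 2^-1 by field.
have -> : cos (y / 2) * (y / 2 * cos c) * 2 = y * (cos (y / 2) * cos c) by field.
exact: ler_wpM2l.
Qed.

(** The symmetry [k -> p - k] reduces to [k <= p/2], where [sin_ge_half] gives at least
    [pi k / (2 p) >= 1 / p]. *)
Lemma sin_pi_frac_ge (p k : nat) : (0 < k < p)%N ->
  p%:R^-1 <= sin (pi * k%:R / p%:R : R).
Proof.
move=> /andP[k0 kp].
have p0 : 0 < p%:R :> R by rewrite ltr0n; lia.
have pi2 := pi_ge2 R.
wlog k2 : k k0 kp / (k.*2 <= p)%N => [th|].
  have [/th|h] := leqP k.*2 p; first exact.
  have := th (p - k)%N; rewrite natrB; last exact: ltnW.
  have -> : pi * (p%:R - k%:R) / p%:R = pi - pi * k%:R / p%:R :> R.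
    by rewrite mulrBr mulrBl mulfK ?gt_eqF.
  by rewrite sinB sinpi cospi mul0r sub0r mulN1r opprK; apply; lia.
have kr : 1 <= k%:R :> R by rewrite ler1n.
have k2r : k%:R * 2 <= p%:R :> R by rewrite -natrM ler_nat; lia.
apply: le_trans (sin_ge_half _ _); last first.
  rewrite divr_ge0 ?mulr_ge0 ?pi_ge0 ?ler0n //= ler_pdivrMr //.
  by rewrite -mulrA ler_wpM2l ?pi_ge0 //; lra.
rewrite mulrAC -[leLHS]mul1r ler_wpM2r ?invr_ge0 ?(ltW p0) //.
by have := ler_pM (ler0n R 2) ler01 pi2 kr; rewrite mulr1; lra.
Qed.

(** Orthogonality of characters in real form: if [p] does not divide [m], the right side of
    [sum_cos_arith] vanishes while [sin (x/2)] does not. *)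
Lemma sum_cos_root_of_unity (p : nat) m : (0 < p)%N ->
  \sum_(k < p) cos (k%:R * (2 * pi * m%:~R / p%:R)) =
  (if (p %| m)%Z then p%:R else 0) :> R.
Proof.
move=> p0.
have pr : p%:R != 0 :> R by rewrite pnatr_eq0; lia.
case: ifPn => [/dvdzP[q ->]|ndiv].
  rewrite (eq_bigr (fun=> 1)) => [|k _]; first by rewrite sumr_const card_ord.
  have -> : k%:R * (2 * pi * (q * p)%:~R / p%:R) = 0 + 2 * pi * (k%:Z * q)%:~R :> R.
    by rewrite !intrM -!pmulrn; field.
  by rewrite -sinDpihalf addrAC sinD2piz sinDpihalf cos0.
have := sum_cos_arith (2 * pi * m%:~R / p%:R) p.
set x := 2 * pi * m%:~R / p%:R.
have -> : p%:R * x - x / 2 = - (x / 2) + 2 * pi * m%:~R by rewrite /x; field.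
rewrite sinD2piz sinN addNr => /eqP; rewrite mulf_eq0 mulf_eq0 pnatr_eq0 /=.
case/orP=> [sx|/eqP //]; exfalso.
(* Reducing [m] modulo [p] turns [sin (x/2)] into plus or minus [sin (pi a / p)] with [0 < a < p],
   which is nonzero. *)
pose a := `|(m %% p)%Z|%N.
have aE : (m %% p)%Z = a%:Z by rewrite /a gez0_abs // modz_ge0; lia.
have a0 : (0 < a < p)%N.
  have := @ltz_pmod m p; rewrite aE lt0n.
  have -> : a != 0%N by apply: contra ndiv => /eqP a0; apply/dvdz_mod0P; rewrite aE a0.
  by lia.
have xE : x / 2 = pi * a%:R / p%:R + pi * (m %/ p)%Z%:~R.
  by rewrite /x {1}(divz_eq m p) aE intrD intrM -!pmulrn; field.
have s0 : sin (pi * a%:R / p%:R : R) != 0.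
  rewrite gt_eqF // (lt_le_trans _ (sin_pi_frac_ge _ _ a0)) //.
  by rewrite invr_gt0 ltr0n.
have spi (q : int) : sin (pi * q%:~R : R) = 0.
  suff st n : sin (pi * n%:R : R) = 0.
    case: q => n; first exact: st.
    by rewrite NegzE mulrNz mulrN sinN st oppr0.
  by elim: n => [|n IH]; rewrite ?mulr0 ?sin0 // -natr1 mulrDr mulr1 sinDpi IH oppr0.
move: sx; rewrite xE sinD spi mulr0 addr0 mulf_eq0 (negbTE s0) /=.
move=> /eqP c0; have := cos2Dsin2 (pi * (m %/ p)%Z%:~R : R).
by rewrite c0 spi !expr0n /= addr0 => /esym /eqP; rewrite oner_eq0.
Qed.

(** With [t = pi k / p] the quantity is [cos^2 t = 1 - sin^2 t], where [sin t >= 1/p]; then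
    [1 - v <= exp (-v)]. *)
Lemma half1Dcos_le_expR (p k : nat) : (0 < k < p)%N ->
  0 <= (1 + cos (2 * pi * k%:R / p%:R : R)) / 2 <= expR (- p%:R ^- 2).
Proof.
move=> kp.
have -> : 2 * pi * k%:R / p%:R = (pi * k%:R / p%:R) *+ 2 :> R.
  by rewrite -[RHS]mulr_natl !mulrA.
rewrite cos_mulr2n cos2sin2.
have h := sin_pi_frac_ge _ _ kp.
set u := sin _ in h *.
have u1 : u ^+ 2 <= 1 by rewrite -[leLHS]ger0_norm ?sqr_ge0 // normrX expr_le1 ?sin_max.
have -> : (1 + ((1 - u ^+ 2) *+ 2 - 1)) / 2 = 1 - u ^+ 2 by rewrite -mulr_natl; field.
rewrite subr_ge0 u1 /= (le_trans _ (expR_ge1Dx _)) // lerD2l lerN2 -exprVn.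
by rewrite lerXn2r ?nnegrE ?invr_ge0 ?ler0n // (le_trans _ h) // invr_ge0.
Qed.

(** * The periodic function [g] of the overview: Fourier expansion and mean over [Z/p] *)

Definition majmod_sin (p : nat) s : R :=
  (-1) ^+ MM p s * sin (2 * pi * s%:~R / p%:R).

Lemma normr_majmod_sin p s : `|majmod_sin p s| <= 1.
Proof. by rewrite normrM normrX normrN1 expr1n mul1r sin_max. Qed.

Lemma MM_modz p s : MM p (s %% p)%Z = MM p s.
Proof. by rewrite /MM modz_mod. Qed.

Lemma majmod_sin_modz (p : nat) s : (0 < p)%N -> majmod_sin p (s %% p)%Z = majmod_sin p s.
Proof.
move=> p0; have pr : p%:R != 0 :> R by rewrite pnatr_eq0; lia.
rewrite /majmod_sin MM_modz -[in LHS](sinD2piz _ (s %/ p)%Z); congr (_ * sin _).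
by rewrite [in RHS](divz_eq s p) [in RHS]intrD intrM -pmulrn; field.
Qed.

(** By orthogonality the sum over [k] is [p] when [a = s] modulo [p] and 0 otherwise. The cosines
    have the shape that [sum_cos_walk] evaluates. *)
Lemma majmod_sin_fourier (p : nat) s : (0 < p)%N ->
  majmod_sin p s = p%:R^-1 * \sum_(a < p) majmod_sin p a%:Z *
     \sum_(k < p) cos (2 * pi * k%:R / p%:R * s%:~R - 2 * pi * k%:R / p%:R * a%:R).
Proof.
move=> p0; have pr : p%:R != 0 :> R by rewrite pnatr_eq0; lia.
have ltp : (`|(s %% p)%Z| < p)%N by have := @ltz_pmod s p; have := @modz_ge0 s p; lia.
have dirac (a : 'I_p) : \sum_(k < p) cos (2 * pi * k%:R / p%:R * s%:~R -
    2 * pi * k%:R / p%:R * a%:R) = (if (p %| s - a%:Z)%Z then p%:R else 0) :> R.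
  rewrite -sum_cos_root_of_unity //; apply: eq_bigr => k _; congr cos.
  by rewrite intrB -pmulrn; field.
under eq_bigr do rewrite dirac.
rewrite (bigD1 (Ordinal ltp)) //= big1 ?addr0; last first.
  move=> a ne; rewrite ifN ?mulr0 //; apply: contra ne => h.
  apply/eqP/val_inj => /=; have ap := ltn_ord a; move: h.
  by rewrite -eqz_mod_dvd => /eqP ->; rewrite modz_small //; lia.
have m0 : 0 <= (s %% p)%Z by apply: modz_ge0; lia.
rewrite gez0_abs // majmod_sin_modz // -eqz_mod_dvd modz_mod eqxx.
by field.
Qed.

(** The sum equals [cot y] with [y = pi / (2 p)], and [cot y >= 1/y - 1]. *)
Lemma sum_majmod_sin_ge (p : nat) : (2 < p)%N -> odd p ->
  p%:R * (2 / pi) - 1 <= \sum_(a < p) majmod_sin p a%:Z.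
Proof.
move=> p2 op; have pr : p%:R != 0 :> R by rewrite pnatr_eq0; lia.
have p0 : 0 < p%:R :> R by rewrite ltr0n; lia.
have pi0 := pi_gt0 R.
pose x : R := 2 * pi / p%:R.
pose q := (p.-1)./2.
have pE : p = (q.+1 + q)%N by rewrite /q; lia.
have sx : 0 < sin (x / 2).
  have := sin_pi_frac_ge p 1; rewrite mulr1 => h.
  have -> : x / 2 = pi / p%:R by rewrite /x; field.
  by rewrite (lt_le_trans _ (h _)) ?invr_gt0 //; lia.
(* The sign is positive up to the threshold [q] and negative above it; the full unsigned sum is
   shown to vanish below. *)
have sE : \sum_(a < p) majmod_sin p a%:Z =
    2 * \sum_(a < q.+1) sin (a%:R * x) - \sum_(a < p) sin (a%:R * x).
  have -> : \sum_(a < p) majmod_sin p a%:Z =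
     \sum_(0 <= a < p) (-1) ^+ (q < a)%N * sin (a%:R * x) :> R.
    rewrite big_mkord; apply: eq_bigr => a _.
    rewrite /majmod_sin /MM modz_small; last by have := ltn_ord a; lia.
    rewrite -/q lez_nat -ltnNge; congr (_ * sin _).
    by rewrite /x -pmulrn; field.
  rewrite -!(big_mkord xpredT (fun a => sin (a%:R * x))).
  rewrite !(@big_cat_nat _ _ _ q.+1 0 p) //=; try lia.
  have -> : \sum_(0 <= i < q.+1) (-1) ^+ (q < i)%N * sin (i%:R * x) =
      \sum_(0 <= i < q.+1) sin (i%:R * x).
    by apply: eq_big_nat => i hi; rewrite (_ : (q < i)%N = false) ?expr0 ?mul1r //; lia.
  have -> : \sum_(q.+1 <= i < p) (-1) ^+ (q < i)%N * sin (i%:R * x) =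
      - \sum_(q.+1 <= i < p) sin (i%:R * x).
    by rewrite -sumrN; apply: eq_big_nat => i /andP[-> _]; rewrite mulN1r.
  by ring.
have e1 := sum_sin_arith x q.+1; have e2 := sum_sin_arith x p.
(* As [2 q + 1 = p], the first block ends at angle [(q + 1/2) x = pi], while the full block closes
   up modulo [2 pi]. *)
have a1 : q.+1%:R * x - x / 2 = pi.
  have : p%:R = q.+1%:R + q%:R :> R by rewrite -natrD -pE.
  rewrite -natr1 => h; rewrite /x.
  have -> : (q%:R + 1) * (2 * pi / p%:R) - 2 * pi / p%:R / 2 =
      (q%:R + 1 + q%:R) * pi / p%:R :> R by field.
  by rewrite -h; field.
have a2 : p%:R * x - x / 2 = - (x / 2) + pi *+ 2.
  by rewrite /x -mulr_natl; field.
rewrite a1 cospi in e1; rewrite a2 cosD2pi cosN subrr in e2.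
have s2 : \sum_(k < p) sin (k%:R * x) = 0.
  by move/eqP: e2; rewrite mulf_eq0 mulf_eq0 pnatr_eq0 /= (gt_eqF sx) => /eqP.
rewrite sE s2 subr0.
have -> : 2 * \sum_(a < q.+1) sin (a%:R * x) = (cos (x / 2) + 1) / sin (x / 2).
  by rewrite opprK in e1; rewrite -e1; field; rewrite gt_eqF.
pose y := x / 4.
have yE : p%:R * (2 / pi) = y^-1.
  by rewrite /y /x; move: (pi : R) pi0 => c c0; field; rewrite pr gt_eqF.
rewrite yE.
have xy : x / 2 = y *+ 2 by rewrite /y -mulr_natl; field.
have y0 : 0 < y by rewrite /y /x !mulr_gt0 ?invr_gt0.
have y2 : y <= pi / 2.
  have h : 3 <= p%:R :> R by rewrite ler_nat.
  rewrite /y /x -(ler_pM2r p0).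
  have -> : 2 * pi / p%:R / 4 * p%:R = pi / 2 :> R by field.
  by rewrite ler_peMr //; lra.
rewrite xy in sx *; rewrite cos_mulr2n sin_mulr2n.
move: sx; rewrite sin_mulr2n -mulr_natl => sx.
have c0 : 0 <= cos y by apply: cos_ge0_pihalf; lra.
have s0 : 0 <= sin y by apply: sin_ge0_pi; lra.
have c1 : 0 < cos y.
  by rewrite lt_def c0 andbT; apply: contraTneq sx => ->; rewrite mul0r mulr0 ltxx.
have s1 : 0 < sin y.
  by rewrite lt_def s0 andbT; apply: contraTneq sx => ->; rewrite !mulr0 ltxx.
rewrite subrK -(mulr_natl (cos y ^+ 2)).
have -> : 2 * cos y ^+ 2 / (2 * (cos y * sin y)) = cos y / sin y.
  by field; rewrite !gt_eqF.
(* Multiplying by [y sin y > 0] leaves [sin y <= (cos y + sin y) y]; the bracket is at least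
   [cos^2 y + sin^2 y = 1]. *)
rewrite lerBlDr -(ler_pM2r y0) mulVf ?gt_eqF // -(ler_pM2r s1) mul1r.
have -> : (cos y / sin y + 1) * y * sin y = (cos y + sin y) * y.
  by field; rewrite gt_eqF.
have cs : 1 <= cos y + sin y.
  have := cos2Dsin2 y; have := cos_le1 y; have := sin_le1 y; nra.
apply: (le_trans (sin_le _ (ltW y0))).
by rewrite ler_peMl // ltW.
Qed.

End RealTrigonometry.

(** * Register positions, bit flips, and parities along tree paths *)

Section Register.
Variable n : nat.
Implicit Types (z w : bits n) (i j : nat).

(** Positions are written exactly as in [edge], [vtx] and [root], so that these fold to evaluation
    at a named position. *)
Definition edge_ord i : 'I_(nq n) := @inord (n.-1 + n.-1) i.-1.
Definition vtx_ord i : 'I_(nq n) := @inord (n.-1 + n.-1) (n.-1 + i.-1).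
Definition root_ord : 'I_(nq n) := @inord (n.-1 + n.-1) (n.-1 + n.-1).

Lemma val_edge_ord i : (0 < i < n)%N -> edge_ord i = i.-1 :> nat.
Proof. by move=> h; rewrite inordK //; lia. Qed.

Lemma val_vtx_ord i : (0 < i < n)%N -> vtx_ord i = (n.-1 + i.-1)%N :> nat.
Proof. by move=> h; rewrite inordK //; lia. Qed.

Lemma val_root_ord : root_ord = (n.-1 + n.-1)%N :> nat.
Proof. by rewrite inordK. Qed.

Lemma prod_register (K : comPzRingType) (G : 'I_(nq n) -> K) : (0 < n)%N ->
  \prod_j G j = (\prod_(1 <= i < n) G (edge_ord i)) *
                (\prod_(1 <= i < n) G (vtx_ord i)) * G root_ord.
Proof.
move=> n0; rewrite big_ord_recr big_split_ord /=; congr (_ * _ * _).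
- rewrite big_add1 big_mkord; apply: eq_bigr => i _.
  by congr G; apply: val_inj; rewrite /= val_edge_ord //; have := ltn_ord i; lia.
- rewrite big_add1 big_mkord; apply: eq_bigr => i _.
  by congr G; apply: val_inj; rewrite /= val_vtx_ord //; have := ltn_ord i; lia.
- by congr G; apply: val_inj; rewrite /= val_root_ord.
Qed.

Lemma register_ord_ind (P : 'I_(nq n) -> Prop) :
  (forall i, (0 < i < n)%N -> P (edge_ord i)) ->
  (forall i, (0 < i < n)%N -> P (vtx_ord i)) -> P root_ord ->
  forall k : 'I_(nq n), P k.
Proof.
move=> Pe Pv Pr j; have jlt : (j < (n.-1 + n.-1).+1)%N := ltn_ord j.
have [h1|h1] := ltnP j n.-1.
  have -> : j = edge_ord j.+1 by apply: val_inj; rewrite /= val_edge_ord //; lia.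
  by apply: Pe; lia.
have [h2|h2] := ltnP j (n.-1 + n.-1).
  have -> : j = vtx_ord (j - n.-1).+1.
    by apply: val_inj; rewrite /= val_vtx_ord; lia.
  by apply: Pv; lia.
have -> : j = root_ord by apply: val_inj; rewrite /= val_root_ord; lia.
exact: Pr.
Qed.

Definition flip (j : 'I_(nq n)) z : bits n := [ffun k => z k (+) (k == j)].

Lemma flipK (j : 'I_(nq n)) : involutive (flip j).
Proof. by move=> z; apply/ffunP => k; rewrite !ffunE -addbA addbb addbF. Qed.

Lemma sum_flip (K : nmodType) (j : 'I_(nq n)) (F : bits n -> K) :
  \sum_z F (flip j z) = \sum_z F z.
Proof. by rewrite [RHS](reindex_inj (inv_inj (flipK j))). Qed.

Lemma edge_flip_edge z i j : (0 < i < n)%N -> (0 < j < n)%N ->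
  edge (flip (edge_ord i) z) j = edge z j (+) (j == i).
Proof.
move=> hi hj; rewrite /edge ffunE -/(edge_ord j); congr (_ (+) _).
by rewrite -val_eqE /= !val_edge_ord //; lia.
Qed.

Lemma edge_flip_vtx z i j : (0 < i < n)%N -> (0 < j < n)%N ->
  edge (flip (vtx_ord i) z) j = edge z j.
Proof.
move=> hi hj; rewrite /edge ffunE -/(edge_ord j) -val_eqE /= val_edge_ord //.
by rewrite val_vtx_ord // (_ : (_ == _) = false) ?addbF //; lia.
Qed.

Lemma edge_flip_root z j : (0 < j < n)%N -> edge (flip root_ord z) j = edge z j.
Proof.
move=> hj; rewrite /edge ffunE -/(edge_ord j) -val_eqE /= val_edge_ord //.
by rewrite val_root_ord // (_ : (_ == _) = false) ?addbF //; lia.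
Qed.

Lemma vtx_flip_edge z i j : (0 < i < n)%N -> (0 < j < n)%N ->
  vtx (flip (edge_ord i) z) j = vtx z j.
Proof.
move=> hi hj; rewrite /vtx ffunE -/(vtx_ord j) -val_eqE /= val_vtx_ord //.
by rewrite val_edge_ord // (_ : (_ == _) = false) ?addbF //; lia.
Qed.

Lemma vtx_flip_vtx z i j : (0 < i < n)%N -> (0 < j < n)%N ->
  vtx (flip (vtx_ord i) z) j = vtx z j (+) (j == i).
Proof.
move=> hi hj; rewrite /vtx ffunE -/(vtx_ord j); congr (_ (+) _).
by rewrite -val_eqE /= !val_vtx_ord //; lia.
Qed.

Lemma vtx_flip_root z j : (0 < j < n)%N -> vtx (flip root_ord z) j = vtx z j.
Proof.
move=> hj; rewrite /vtx ffunE -/(vtx_ord j) -val_eqE /= val_vtx_ord //.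
by rewrite val_root_ord // (_ : (_ == _) = false) ?addbF //; lia.
Qed.

Lemma root_flip_root z : Defs.root (flip root_ord z) = ~~ Defs.root z.
Proof. by rewrite /Defs.root ffunE eqxx addbT. Qed.

(** Taking parents never increases the index. Hence [h(d)_i] depends only on [d_1, ..., d_i], and
    the walk can be treated one vertex at a time. *)
Lemma on_path_leq j i : on_path j i -> (j <= i)%N.
Proof.
case/andP=> _ /existsP[k /eqP <-].
elim: {k}(k : nat) => //= k IH; apply: leq_trans IH.
by rewrite /parent; lia.
Qed.

Lemma on_path_refl i : (0 < i)%N -> on_path i i.
Proof. by move=> i0; rewrite /on_path i0; apply/existsP; exists ord0. Qed.

Lemma xorb_addb : xorb = addb.
Proof. by apply/funext => -[]; apply/funext => -[]. Qed.

Lemma eq_hz z w i : (forall j, (0 < j < n)%N -> (j <= i)%N -> edge z j = edge w j) ->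
  hz z i = hz w i.
Proof.
move=> h; rewrite /hz /hfun big_nat_cond [RHS]big_nat_cond.
by apply: eq_bigr => j /andP[hj /on_path_leq ji]; exact: h.
Qed.

(** The edge [e_i] lies on the path to [v_i], so exactly one term of the xor changes. *)
Lemma hz_flip_edge z i : (0 < i < n)%N -> hz (flip (edge_ord i) z) i = ~~ hz z i.
Proof.
move=> hi; rewrite /hz /hfun xorb_addb big_nat_cond.
under eq_bigr => j /andP[hj _] do rewrite edge_flip_edge //.
rewrite big_split -big_nat_cond /= -addbT; congr (_ (+) _).
rewrite big_mkcond (bigD1_seq i) ?mem_index_iota ?iota_uniq //=.
rewrite big1 ?addbF => [|j /negbTE ->]; last by rewrite if_same.
by rewrite eqxx hi on_path_refl //; case/andP: hi.
Qed.

(** * The sum [S] and its partial sums as a lazy random walk *)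

Definition walk z m : int :=
  \sum_(1 <= i < m) (nat_of_bool (vtx z i))%:Z * (-1) ^+ (nat_of_bool (hz z i)).

(** Step [i] reads only [x_i] and the [d_j] with [j <= i], so the bits of index [m] and beyond
    remain free to be flipped. *)
Lemma eq_walk z w m : (m <= n)%N ->
  (forall i, (0 < i < m)%N -> vtx z i = vtx w i /\ edge z i = edge w i) ->
  walk z m = walk w m.
Proof.
move=> mn h; apply: eq_big_nat => i hi.
have [-> _] := h i hi; rewrite (@eq_hz z w) // => j hj ji.
by have [|] := h j => //; lia.
Qed.

(* Flipping the bits [x_m] and [d_m] leaves [walk z m] alone and averages the
   [m]-th step over [0, 0, 1, -1]. *)
Lemma sum_cos_walk (t c : RR) m : (m.+1 <= n)%N ->
  \sum_z cos (t * (walk z m.+1)%:~R - c) =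
  ((1 + cos t) / 2) ^+ m * (2 ^+ nq n * cos c).
Proof.
elim: m => [|m IHm] mn.
  rewrite expr0 mul1r (eq_bigr (fun=> cos c)) => [|z _].
    by rewrite sumr_const -[LHS]mulr_natl card_ffun card_bool card_ord natrX.
  by rewrite /walk big_geq // mulr0 sub0r cosN.
rewrite exprS -mulrA -IHm; last exact: ltnW.
set i := m.+1; have hi : (0 < i < n)%N by rewrite /i; lia.
pose F z := cos (t * (walk z i.+1)%:~R - c).
have e4 : \sum_z F z = (\sum_z (F z + F (flip (vtx_ord i) z) +
    (F (flip (edge_ord i) z) + F (flip (vtx_ord i) (flip (edge_ord i) z))))) / 4.
  rewrite !big_split /= (sum_flip _ (edge_ord i) (fun z => F (flip (vtx_ord i) z))).
  by rewrite !sum_flip; field.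
rewrite -/(F _) e4 [RHS]mulr_sumr mulr_suml; apply: eq_bigr => z _.
have walkS w : walk w i.+1 =
    walk w i + (nat_of_bool (vtx w i))%:Z * (-1) ^+ (nat_of_bool (hz w i)).
  by rewrite /walk big_nat_recr.
have wv w : walk (flip (vtx_ord i) w) i = walk w i.
  apply: eq_walk => [|j hj]; first by lia.
  rewrite vtx_flip_vtx ?edge_flip_vtx //; lia.
have we w : walk (flip (edge_ord i) w) i = walk w i.
  apply: eq_walk => [|j hj]; first by lia.
  rewrite vtx_flip_edge ?edge_flip_edge //; lia.
have hv w : hz (flip (vtx_ord i) w) i = hz w i.
  by apply: eq_hz => j hj _; rewrite edge_flip_vtx.
rewrite /F !walkS !(wv, we, hv, hz_flip_edge, vtx_flip_vtx, vtx_flip_edge) //.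
rewrite eqxx addbT.
set s := (walk z i).
have eA (e : int) : t * (s + e)%:~R - c = (t * s%:~R - c) + t * e%:~R.
  by rewrite intrD; ring.
rewrite !eA; move: (t * s%:~R - c) => A.
(* Each case only permutes the four steps: [2 cos A + cos (A + t) + cos (A - t) = 2 cos A (1 + cos
   t)]. *)
case: (vtx z i); case: (hz z i); rewrite /= ?mul0r ?mul1r ?expr0 ?expr1 ?mulr0 ?addr0
  ?mulr1 ?mulrN1 ?cosB ?cosD ?mulrN ?cosN ?sinN ?cosD ?cosB; by field.
Qed.

End Register.

Arguments flip {n} j z.
Arguments walk {n} z m.

(** * Complex phases and matrix entries of the gates *)

Definition cis (t : RR) : CC := Complex (cos t) (sin t).

Lemma cisD (s t : RR) : cis (s + t) = cis s * cis t.
Proof. by rewrite /cis cosD sinD [sin s * _ + _]addrC. Qed.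

Lemma cis0 : cis 0 = 1.
Proof. by rewrite /cis cos0 sin0. Qed.

Lemma sqnormM (a b : CC) : sqnorm (a * b) = sqnorm a * sqnorm b.
Proof. by case: a b => [a1 a2] [b1 b2] /=; ring. Qed.

Lemma sqnorm_rc (x : RR) : sqnorm (rc x) = x ^+ 2.
Proof. by rewrite /sqnorm /= expr0n addr0. Qed.

Lemma sqnormX (a : CC) k : sqnorm (a ^+ k) = sqnorm a ^+ k.
Proof.
elim: k => [|k IH]; last by rewrite !exprS sqnormM IH.
by rewrite !expr0 /= expr1n expr0n addr0.
Qed.

Lemma sqnorm_sign (b : bool) : sqnorm ((-1) ^+ b) = 1.
Proof. by rewrite sqnormX /= sqrrN expr1n oppr0 expr0n addr0 expr1n. Qed.

Lemma boF : bo false = 0.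
Proof. by apply: val_inj; rewrite /= inordK. Qed.

Lemma boT : bo true = 1.
Proof. by apply: val_inj; rewrite /= inordK. Qed.

Lemma conj_Complex (a b : RR) : Num.conj (Complex a b : CC) = Complex a (- b).
Proof. by []. Qed.

(** Row 1 of the adjoint is [<1| e^{i theta X}], and column [w] of [Had] is an eigenvector of [X]
    for [(-1)^w]; this produces the phase. Row 0 is [<0|] and carries none. *)
Lemma vertex_opE (theta : RR) (x w : bool) :
  (adjM (Aop theta) *m Had) (bo x) (bo w) =
  rc (Num.sqrt 2)^-1 *
    ((-1) ^+ (x && w) * cis (theta * ((nat_of_bool x)%:Z * (-1) ^+ w)%:~R)).
Proof.
rewrite !mxE !big_ord_recl big_ord0 !mxE !big_ord_recl !big_ord0 !mxE /=.
set r := (Num.sqrt 2)^-1.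
case: x; case: w; rewrite ?boF ?boT /=;
  rewrite !(mulr0, mul0r, mulr1, mul1r, addr0, add0r, sub0r, oppr0, expr0, expr1);
  rewrite ?mulrNz ?mulr1z ?mulrN ?mulr1 ?mulr0 ?cis0 ?rmorphN ?rmorph1 ?rmorph0 /rc
    ?conj_Complex /cis ?cosN ?sinN ?mul0r ?addr0 ?mul1r ?mulr1 //;
  apply/eqP; rewrite eq_complex /=; apply/andP; split; apply/eqP; ring.
Qed.

Lemma cos_piquarter : cos (pi / 4 : RR) = (Num.sqrt 2)^-1.
Proof.
have c0 : 0 <= cos (pi / 4 : RR).
  by apply: cos_ge0_pihalf; have := pi_gt0 RR; lra.
by rewrite -sqrtrV // -cos_piquarter_sqr sqrtr_sqr ger0_norm.
Qed.

Lemma sin_piquarter : sin (pi / 4 : RR) = (Num.sqrt 2)^-1.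
Proof.
have c0 : 0 <= sin (pi / 4 : RR).
  by apply: sin_ge0_pi; have := pi_gt0 RR; lra.
rewrite -sqrtrV // -[LHS]ger0_norm // -sqrtr_sqr sin2cos2 cos_piquarter_sqr.
by congr Num.sqrt; field.
Qed.

Lemma sqr_invsqrt2 : (Num.sqrt 2 : RR)^-1 ^+ 2 = 2^-1.
Proof. by rewrite exprVn sqr_sqrtr. Qed.

(** Column [b] of [Had] is an eigenvector of [X] for [(-1)^b], so it gains the phase
    [e^{-i (-1)^b pi/4}]; with [1 / sqrt 2] this is [(1 - (-1)^b i) / 2]. *)
Lemma root_opE (r b : bool) :
  (expmiX (pi / 4) *m Had) (bo r) (bo b) =
  (-1) ^+ (r && b) * Complex 2^-1 (if b then 2^-1 else - 2^-1).
Proof.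
rewrite !mxE !big_ord_recl !big_ord0 !mxE /= cos_piquarter sin_piquarter.
have := sqr_invsqrt2; set s := (Num.sqrt 2)^-1 => ss.
case: r; case: b; rewrite ?boF ?boT /=;
  rewrite !(mulr0, mulr1, mul1r, addr0, add0r, sub0r, subr0, oppr0, expr0, expr1);
  rewrite /rc -ss; apply/eqP; rewrite eq_complex /=;
  apply/andP; split; apply/eqP; ring.
Qed.

Lemma prod_sign (K : pzRingType) a b (F : nat -> bool) :
  \prod_(a <= i < b) (-1) ^+ F i = (-1) ^+ (\big[addb/false]_(a <= i < b) F i) :> K.
Proof.
by rewrite (big_morph (fun b : bool => (-1) ^+ b : K) (@signr_addb K) (erefl _)).
Qed.

(** * Amplitudes of the state [psi] *)

Section State.
Variables p n : nat.
Implicit Types z w : bits n.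

Lemma bits_ext z w :
  (forall i, (0 < i < n)%N -> edge z i = edge w i) ->
  (forall i, (0 < i < n)%N -> vtx z i = vtx w i) ->
  Defs.root z = Defs.root w -> z = w.
Proof. by move=> he hv hr; apply/ffunP; exact: register_ord_ind. Qed.

(* The basis state in the support of [PM] with root bit [b] and the edge bits of [z]. *)
Definition branch (b : bool) z : bits n :=
  [ffun j : 'I_(nq n) => if (j < n.-1)%N then z j
             else if (j < n.-1 + n.-1)%N then hz z (j - n.-1).+1 (+) b else b].

Lemma edge_branch b z i : (0 < i < n)%N -> edge (branch b z) i = edge z i.
Proof.
move=> hi; rewrite /edge ffunE -/(edge_ord n i) val_edge_ord // ifT //; lia.
Qed.

Lemma vtx_branch b z i : (0 < i < n)%N -> vtx (branch b z) i = hz z i (+) b.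
Proof.
move=> hi; rewrite /vtx ffunE -/(vtx_ord n i) val_vtx_ord //.
by rewrite ifF ?ifT; [congr (hz _ _ (+) _)| |]; lia.
Qed.

Lemma root_branch b z : Defs.root (branch b z) = b.
Proof. by rewrite /Defs.root ffunE -/(root_ord n) val_root_ord ifF ?ifF //; lia. Qed.

Lemma eq_branch b z w : (forall i, (0 < i < n)%N -> edge z i = edge w i) ->
  branch b z = branch b w.
Proof.
move=> h; apply: bits_ext => [i hi|i hi|]; rewrite ?root_branch //.
  by rewrite !edge_branch // h.
by rewrite !vtx_branch //; congr (_ (+) _); apply: eq_hz => j hj _; exact: h.
Qed.

(** Recasts the indicators of [PM] as fixed-point equations. *)
Lemma PM_support b w :
  [forall i : 'I_n, (1 <= i)%N ==> (vtx w i == hz w i (+) b)] && (Defs.root w == b) =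
  (w == branch b w).
Proof.
apply/andP/eqP => [[/forallP hv /eqP hr]|->].
  apply: bits_ext => [i hi|i hi|]; rewrite ?root_branch ?edge_branch ?vtx_branch //.
  have [i0 iN] := andP hi.
  by have := hv (Ordinal iN); rewrite /= i0 => /eqP.
rewrite root_branch eqxx; split=> //; apply/forallP => i; apply/implyP => i0.
rewrite vtx_branch ?i0 ?ltn_ord //; apply/eqP; congr (_ (+) _).
by apply: eq_hz => j hj _; rewrite edge_branch.
Qed.

Lemma PM_E w : PM w = rc ((Num.sqrt 2) ^- n.-1) * rc (Num.sqrt 2)^-1 *
  (indC (w == branch false w) + indC (w == branch true w)).
Proof.
rewrite -!PM_support /PM; congr (_ * (indC (_ && _) + indC (_ && _))).
  by apply: eq_forallb => i; rewrite addbF.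
by apply: eq_forallb => i; rewrite addbT.
Qed.

Definition gate z w : CC := \prod_(j < nq n) @opsPM p n j (bo (z j)) (bo (w j)).

Lemma opsPM_edge i : (0 < i < n)%N -> @opsPM p n (edge_ord n i) = 1%:M.
Proof. by move=> hi; rewrite /opsPM val_edge_ord // ifT //; lia. Qed.

Lemma opsPM_vtx i : (0 < i < n)%N ->
  @opsPM p n (vtx_ord n i) = adjM (Aop (pi / p%:R)) *m Had.
Proof. by move=> hi; rewrite /opsPM val_vtx_ord // ifF ?ifT //; lia. Qed.

Lemma opsPM_root : @opsPM p n (root_ord n) = expmiX (pi / 4) *m Had.
Proof. by rewrite /opsPM val_root_ord ifF ?ifF //; lia. Qed.

Lemma bo_inj : injective bo.
Proof. by move=> [] [] //; rewrite boF boT. Qed.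

(** The identity gates kill [gate z w] unless [z] and [w] share their edge bits, and then their
    branches agree. The surviving [w] thus depends on [z] alone. *)
Lemma gate_branch b z w :
  gate z w * indC (w == branch b w) = gate z w * indC (w == branch b z).
Proof.
have [h|/existsNP[i /not_implyP[hi ne]]] :=
    pselect (forall i, (0 < i < n)%N -> edge z i = edge w i).
  by rewrite (@eq_branch b z w).
suff -> : gate z w = 0 by rewrite !mul0r.
rewrite /gate (bigD1 (edge_ord n i)) //= opsPM_edge // mxE.
by rewrite (inj_eq bo_inj) (_ : (_ == _) = false) ?mul0r //; apply/eqP.
Qed.

Lemma psi_gate z : psi p z = rc ((Num.sqrt 2) ^- n.-1) * rc (Num.sqrt 2)^-1 *
  (gate z (branch false z) + gate z (branch true z)).
Proof.
have pick (u : bits n) : \sum_w gate z w * indC (w == u) = gate z u.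
  rewrite (bigD1 u) //= eqxx mulr1 big1 ?addr0 // => w /negbTE ->.
  by rewrite mulr0.
rewrite /psi /apply_local -[gate _ _]pick -[gate _ (branch true _)]pick.
rewrite -big_split mulr_sumr.
apply: eq_bigr => w _; rewrite PM_E -/(gate z w) -!gate_branch.
by rewrite mulrCA mulrDr.
Qed.

Lemma parity_addb z : parity_x z = \big[addb/false]_(1 <= i < n) vtx z i.
Proof. by rewrite /parity_x xorb_addb. Qed.

(** Going from [b = false] to [b = true] complements [h], which conjugates the vertex phases and
    adds the sign of [parity_x z]. The first sign factor is common to both branches and drops out of
    the squared modulus. *)
Lemma gate_branchE b z : (0 < n)%N -> gate z (branch b z) =
  rc (Num.sqrt 2)^-1 ^+ n.-1 *
  (-1) ^+ (\big[addb/false]_(1 <= i < n) (vtx z i && hz z i)) *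
  ((-1) ^+ (b && (parity_x z (+) Defs.root z)) *
   cis (pi / p%:R * ((-1) ^+ b * walk z n)%:~R) *
   Complex 2^-1 (if b then 2^-1 else - 2^-1)).
Proof.
move=> n0; rewrite /gate prod_register //.
rewrite big1_seq ?mul1r; last first.
  move=> i; rewrite mem_index_iota => hi.
  by rewrite opsPM_edge // -/(edge _ _) -/(edge _ _) edge_branch // mxE eqxx.
rewrite opsPM_root -/(Defs.root _) -/(Defs.root _) root_branch root_opE.
under eq_big_nat => i hi.
  rewrite opsPM_vtx // -/(vtx _ _) -/(vtx _ _) vtx_branch // vertex_opE.
over.
rewrite !big_split /= prodr_const_nat subn1 prod_sign -(big_morph cis cisD cis0).
rewrite -mulr_sumr -rmorph_sum /=.
have -> : \sum_(1 <= i < n) (nat_of_bool (vtx z i))%:Z * (-1) ^+ (hz z i (+) b) =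
    (-1) ^+ b * walk z n.
  rewrite mulr_sumr; apply: eq_bigr => i _.
  by rewrite signr_addb; ring.
have -> : \big[addb/false]_(1 <= i < n) (vtx z i && (hz z i (+) b)) =
    \big[addb/false]_(1 <= i < n) (vtx z i && hz z i) (+) (b && parity_x z).
  rewrite parity_addb; under eq_bigr do rewrite andb_addr.
  rewrite big_split; congr (_ (+) _); case: b => /=.
    by apply: eq_bigr => i _; rewrite andbT.
  by rewrite big1 // => i _; rewrite andbF.
rewrite andb_addr !signr_addb [Defs.root z && b]andbC.
by ring.
Qed.

Lemma sqnorm_psi z : (0 < n)%N -> sqnorm (psi p z) =
  (2 ^+ (n.-1 + n.-1))^-1 * 2^-1 *
  (1 + (-1) ^+ (parity_x z (+) Defs.root z) * sin (2 * pi * (walk z n)%:~R / p%:R)).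
Proof.
move=> n0; rewrite psi_gate !gate_branchE // -mulrDr.
rewrite !sqnormM sqnormX sqnorm_sign !sqnorm_rc.
rewrite -!exprVn ![_ ^+ n.-1 ^+ 2]exprAC !sqr_invsqrt2 mulr1 exprD.
rewrite [RHS](_ : _ = 2^-1 ^+ n.-1 * 2^-1 * (2^-1 ^+ n.-1 *
  (1 + (-1) ^+ (parity_x z (+) Defs.root z) *
     sin (2 * pi * (walk z n)%:~R / p%:R)))); last by ring.
congr (_ * (_ * _)).
rewrite andFb andTb [nat_of_bool false]/= [nat_of_bool true]/=.
rewrite !(expr0, expr1, mul1r) mulN1r mulrNz mulrN.
have -> : 2 * pi * (walk z n)%:~R / p%:R = (pi / p%:R * (walk z n)%:~R) *+ 2 :> RR.
  by rewrite -[RHS]mulr_natl; ring.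
(* With [u = pi S / p] the bracket is [e^{i u} (1 - i) / 2] plus or minus its conjugate, that is
   [cos u + sin u] or [i (sin u - cos u)]. *)
move: (pi / p%:R * _) => u; rewrite sin_mulr2n /cis cosN sinN.
have := cos2Dsin2 u; move: (cos u) (sin u) => c s cs.
by case: (_ (+) _); rewrite /= ?expr0 ?expr1 ?mul1r ?mulN1r /=
  -[X in _ = X + _]cs -[(c * s) *+ 2]mulr_natl; field.
Qed.

End State.

(** * Total variation distance in terms of the mean of [g] *)

Section Distance.
Variables p n : nat.
Hypotheses (p_gt0 : (0 < p)%N) (n_gt0 : (0 < n)%N).
Implicit Types z : bits n.

Let U : RR := (2 ^+ (n.-1 + n.-1))^-1.

(** The register holds the root bit besides the bits of [Z], so the uniform weight of [Z] is counted
    twice. *)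
Lemma sum_uniform_bits : \sum_(z : bits n) U = 2.
Proof.
rewrite sumr_const card_ffun card_bool card_ord -[LHS]mulr_natl natrX /nq exprS.
by rewrite /U mulfK // expf_neq0.
Qed.

Lemma walk_flip_root z : walk (flip (root_ord n) z) n = walk z n.
Proof. by apply: eq_walk => // i hi; rewrite vtx_flip_root // edge_flip_root. Qed.

Lemma parity_flip_root z : parity_x (flip (root_ord n) z) = parity_x z.
Proof. by apply: eq_big_nat => i hi; rewrite vtx_flip_root. Qed.

(** Flipping the root bit reverses the sign of the sine term, so it cancels in pairs. *)
Lemma sum_sqnorm_psi : \sum_(z : bits n) sqnorm (psi p z) = 1.
Proof.
have : \sum_(z : bits n) (sqnorm (psi p z) + sqnorm (psi p (flip (root_ord n) z))) = 2.
  rewrite -sum_uniform_bits; apply: eq_bigr => z _.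
  rewrite !sqnorm_psi // walk_flip_root parity_flip_root root_flip_root addbN.
  by rewrite signrN /U; field; rewrite expf_neq0.
by rewrite big_split /= (sum_flip _ _ _ (fun z => sqnorm (psi p z))) => h; lra.
Qed.

Lemma tvd_psi : tvd (meas_dist (@psi p n)) (@target_dist p n) =
  2^-1 - 4^-1 * (U * \sum_(z : bits n) majmod_sin RR p (walk z n)).
Proof.
(* If the root bit matches the target, the masses are [U (1 + g) / 2] and [U]; otherwise
   [U (1 - g) / 2] and 0. The gap is [U (1 - g) / 2] both times. *)
have point z : `|meas_dist (@psi p n) z - target_dist p z| =
    2^-1 * U - 2^-1 * (U * majmod_sin RR p (walk z n)).
  rewrite /meas_dist sum_sqnorm_psi divr1 sqnorm_psi // /target_dist -/U.
  have U0 : 0 < U by rewrite invr_gt0 exprn_gt0.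
  have -> : pmmajmod p z = MM p (walk z n) (+) parity_x z by [].
  rewrite /majmod_sin; set s := sin _.
  have h1 : 0 <= U * (1 + s) by rewrite mulr_ge0 ?(ltW U0) // -lerBlDl sub0r sin_geN1.
  have h2 : 0 <= U * (1 - s) by rewrite mulr_ge0 ?(ltW U0) // subr_ge0 sin_le1.
  rewrite (_ : (Defs.root z == _) =
      (MM p (walk z n) == parity_x z (+) Defs.root z)); last first.
    by case: (MM _ _) (parity_x z) (Defs.root z) => [] [] [].
  case: (parity_x z (+) Defs.root z); case: (MM p (walk z n));
    rewrite /= ?expr0 ?expr1 ?mul1r ?mulN1r ?mulr1 ?mulr0 ?subr0.
  - by rewrite ler0_norm; lra.
  - by rewrite ger0_norm; lra.
  - by rewrite ger0_norm; lra.
  - by rewrite ler0_norm; lra.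
rewrite /tvd; under eq_bigr do rewrite point.
by rewrite sumrB -!mulr_sumr sum_uniform_bits; field.
Qed.

(** The character [k = 0] yields the sum of [g] over [Z/p]; each other pair [(a, k)] costs at most
    the damping factor. The leading 2 is the total weight of [U]. *)
Lemma mean_majmod_sin_ge :
  2 / p%:R * (\sum_(a < p) majmod_sin RR p a%:Z -
     p%:R ^+ 2 * expR (- p%:R ^- 2) ^+ n.-1) <=
  U * \sum_(z : bits n) majmod_sin RR p (walk z n).
Proof.
have pr : 0 < p%:R :> RR by rewrite ltr0n.
set E := expR _ ^+ _.
pose lam (k : nat) : RR := ((1 + cos (2 * pi * k%:R / p%:R)) / 2) ^+ n.-1.
have walkE (t c : RR) : \sum_(z : bits n) cos (t * (walk z n)%:~R - c) =
    ((1 + cos t) / 2) ^+ n.-1 * (2 ^+ nq n * cos c).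
  by have := @sum_cos_walk n t c n.-1; rewrite prednK //; apply.
have U2 : U * 2 ^+ nq n = 2.
  rewrite -[RHS]sum_uniform_bits sumr_const card_ffun card_bool card_ord.
  by rewrite -[RHS]mulr_natr natrX.
have -> : \sum_(z : bits n) majmod_sin RR p (walk z n) =
    p%:R^-1 * (2 ^+ nq n * \sum_(a < p) \sum_(k < p) majmod_sin RR p a%:Z *
      (lam k * cos (2 * pi * k%:R / p%:R * a%:R))).
  under eq_bigr do rewrite majmod_sin_fourier //.
  rewrite -mulr_sumr exchange_big /=; congr (_ * _).
  rewrite mulr_sumr; apply: eq_bigr => a _.
  rewrite -mulr_sumr exchange_big /= !mulr_sumr; apply: eq_bigr => k _.
  by rewrite walkE /lam; ring.
rewrite mulrCA [U * _]mulrA U2 mulrA [_^-1 * 2]mulrC.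
apply: ler_wpM2l; first by rewrite divr_ge0 ?ler0n.
rewrite lerBlDr -lerBlDl -sumrB.
(* Spreading the error over all pairs [(a, k)] allows a termwise comparison; the pairs with [k = 0]
   leave a spare [E >= 0]. *)
have -> : p%:R ^+ 2 * E = \sum_(a < p) \sum_(k < p) E.
  by rewrite !(sumr_const, card_ord) -!mulrnA -[RHS]mulr_natl natrM expr2.
apply: ler_sum => a _.
have E0 : 0 <= E by rewrite exprn_ge0 ?expR_ge0.
have lam0 : lam 0%N = 1.
  by rewrite /lam mulr0 mul0r cos0 (_ : (1 + 1) / 2 = 1 :> RR) ?expr1n //; field.
rewrite !(bigD1 (Ordinal p_gt0) isT) /= lam0 mul1r !(mulr0, mul0r) cos0 mulr1.
rewrite opprD addrA subrr add0r -[leLHS]add0r lerD // -sumrN; apply: ler_sum => k.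
rewrite -val_eqE /= -lt0n => k0; have kp := ltn_ord k.
apply: le_trans (ler_norm _) _; rewrite normrN normrM (normrM (lam k)).
have /andP[l0 l1] := half1Dcos_le_expR RR p k (introT andP (conj k0 kp)).
rewrite -[leRHS]mul1r ler_pM ?mulr_ge0 ?normr_majmod_sin //.
rewrite -[leRHS]mulr1 ler_pM ?cos_max // ger0_norm ?exprn_ge0 //.
by rewrite lerXn2r // nnegrE expR_ge0.
Qed.

End Distance.

(** * From the mean of [g] to the explicit error bound *)

Theorem theorem6p5 :
  exists C : RR, forall (p n : nat), prime p -> odd p -> (2 <= n)%N ->
    @tvd n (@meas_dist n (@psi p n)) (@target_dist p n)
    <= 2^-1 - pi^-1 + (2 * p%:R)^-1
       + C * (p%:R * Num.sqrt p%:R) * expR (- (n%:R / (4 * p%:R ^+ 2))).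
Proof.
(* The error obtained is [p E / 2], which is below [p^(3/2) E] since [sqrt p >= 1]. *)
exists 1 => p n p_pr p_odd n2.
have p0 : (0 < p)%N := prime_gt0 p_pr.
have p3 : (2 < p)%N by have := prime_gt1 p_pr; lia.
have n0 : (0 < n)%N by lia.
have pr : 0 < p%:R :> RR by rewrite ltr0n.
have p1 : 1 <= p%:R :> RR by rewrite ler1n.
rewrite tvd_psi // mul1r.
have mean := mean_majmod_sin_ge p n p0 n0.
have usum := sum_majmod_sin_ge RR p p3 p_odd.
(* Uses [n <= 4 (n - 1)], valid for [n >= 2]. *)
have decay : expR (- p%:R ^- 2) ^+ n.-1 <= expR (- (n%:R / (4 * p%:R ^+ 2))) :> RR.
  rewrite -expRM_natl ler_expR mulrN lerN2 invfM mulrA.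
  rewrite ler_wpM2r ?invr_ge0 ?exprn_ge0 ?ler0n //.
  have h : n%:R <= n.-1%:R * 4 :> RR by rewrite -natrM ler_nat; lia.
  by rewrite ler_pdivrMr.
move: decay mean usum; set D := expR _ ^+ _; set E := expR (- (n%:R / _)).
set M := (_ * \sum_(z : bits n) _); set T := \sum_(a < p) _ => decay mean usum.
have s1 : 1 <= Num.sqrt p%:R :> RR by rewrite -[leLHS]sqrtr1 ler_wsqrtr.
have E0 : 0 <= E by exact: expR_ge0.
have pE : p%:R * E <= p%:R * Num.sqrt p%:R * E.
  by rewrite ler_wpM2r // ler_peMr // ltW.
have pE0 : 0 <= p%:R * E by rewrite mulr_ge0 // ltW.
have pi0 := pi_gt0 RR.
(* Subtracting a quarter of this from [1/2] gives [1/2 - 1/pi + 1/(2 p) + p E / 2]. *)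
suff : 2 * (2 / pi - p%:R^-1) - 2 * (p%:R * E) <= M.
  rewrite invfM; lra.
apply: le_trans mean.
have -> : 2 * (2 / pi - p%:R^-1) - 2 * (p%:R * E) =
   2 / p%:R * (p%:R * (2 / pi) - 1 - p%:R ^+ 2 * E).
  by move: (pi : RR) pi0 => c c0; field; rewrite !gt_eqF.
rewrite ler_wpM2l ?divr_ge0 ?ler0n // lerB // ler_wpM2l // exprn_ge0 // ltW.
Qed.
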